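(* Let $n\ge1$, $m\ge 1$ and $1\le \ell\le m$ be integers, and let $\Gamma=([n],A(\Gamma))$ be a simple digraph. Let $$\mathcal C_n^{m,\ell}(\Gamma)=\mathcal C_n^m\setminus\{x_i-x_j=\ell\mid (i,j)\in A(\Gamma)\}$$ be the $\ell$-layer digraph-deleted Catalan arrangement in $\mathbb R^n$, and put $\theta_n^{m,\ell}(k)=(m-\ell)k+\ell n+1$. Then: (1) If $1\le \ell\le\lfloor m/2\rfloor$, then $$\chi(\mathcal C_n^{m,\ell}(\Gamma),t)=t\sum_{k=\lceil n/2\rceil}^{n}\mathrm{mat}_{n-k}(\Gamma)\,(t-\theta_n^{m,\ell}(k))^{\underline{k-1}}.$$ (2) If $\lfloor m/2\rfloor+1\le \ell\le m$, then $$\chi(\mathcal C_n^{m,\ell}(\Gamma),t)=t\sum_{k=1}^{n}\mathrm{path}_k(\Gamma)\,(t-\theta_n^{m,\ell}(k))^{\underline{k-1}}.$$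
   Context: Notation: $[n]=\{1,\dots,n\}$. Falling factorial: $x^{\underline r}=x(x-1)\cdots(x-r+1)$, $x^{\underline 0}=1$. The full $m$-Catalan arrangement in $\mathbb R^n$ is the set of hyperplanes $$\mathcal C_n^m=\{x_i-x_j=0\mid 1\le i<j\le n\}\cup\{x_i-x_j=s\mid 1\le i\ne j\le n,\ 1\le s\le m\}.$$ For a finite hyperplane arrangement $\mathcal A$ in $\mathbb R^n$, $L(\mathcal A)$ is the poset of nonempty intersections of subfamilies of $\mathcal A$, ordered by reverse inclusion, with minimum $\hat 0=\mathbb R^n$ (the empty intersection). With $\mu$ the Möbius function of $L(\mathcal A)$, the characteristic polynomial is $\chi(\mathcal A,t)=\sum_{X\in L(\mathcal A)}\mu(\hat 0,X)t^{\dim X}$. A simple digraph has no loops and no repeated arcs (both $(i,j)$ and $(j,i)$ may be present). A matching in $\Gamma$ is a set of pairwise vertex-disjoint arcs; $\mathrm{mat}_k(\Gamma)$ is the number of matchings with $k$ arcs. A path cover of $\Gamma$ is a set of vertex-disjoint directed paths of $\Gamma$ covering all vertices, with isolated vertices allowed as paths of length $0$; $\mathrm{path}_k(\Gamma)$ is the number of path covers with exactly $k$ directed paths. *)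

(* Defs.v *)
From HB Require Import structures.
From mathcomp Require Export all_boot all_order all_algebra.
From mathcomp Require Export finmap.
From mathcomp Require Export boolp classical_sets reals.
Set Implicit Arguments.
Unset Strict Implicit.
Unset Printing Implicit Defensive.
Import Order.TTheory GRing.Theory Num.Theory.
Local Open Scope ring_scope.
Local Open Scope fset_scope.

Section Moebius.
Context {d : Order.disp_t} {T : porderType d}.

(* [k] is only fuel: a chain of [L] has at most [#|` L|] elements, and
   [moebiusE] is the usual recursion. *)
Fixpoint moebius_rec (L : {fset T}) (k : nat) (x y : T) : int :=
  if k is k'.+1 then
    if x == y then 1
    else if (x < y)%O then
      - \sum_(z <- L | (x <= z < y)%O) moebius_rec L k' x z
    else 0
  else 0.

(* The Moebius function of the finite poset [L], ordered as a subset of [T] *)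
Definition moebius (L : {fset T}) (x y : T) : int :=
  moebius_rec L #|` L| x y.

Lemma moebius_rec_stable (L : {fset T}) (x : T) k1 k2 y :
  y \in L ->
  (#|` [fset z in L | (z <= y)%O]| <= k1)%N ->
  (#|` [fset z in L | (z <= y)%O]| <= k2)%N ->
  moebius_rec L k1 x y = moebius_rec L k2 x y.
Proof.
have pos t : t \in L -> (#|` [fset z in L | (z <= t)%O]| <= 0)%N = false.
  move=> tL; rewrite leqn0 cardfs_eq0; apply/negbTE/fset0Pn.
  by exists t; rewrite !inE tL /=.
elim: k1 k2 y => [|k1 IH] [|k2] y yL; rewrite ?pos //.
move=> h1 h2 /=; case: eqP => // _; case: ifP => // _; congr (- _).
rewrite big_seq_cond [RHS]big_seq_cond; apply: eq_bigr => z /and3P[zL _ zy].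
have lt : (#|` [fset t in L | (t <= z)%O]| < #|` [fset t in L | (t <= y)%O]|)%N.
  apply: fproper_ltn_card; rewrite fproperE; apply/andP; split; last first.
    by apply/fsubsetPn; exists y; rewrite !inE yL ?lexx //= lt_geF.
  apply/fsubsetP => t; rewrite !inE => /andP[-> /le_trans] /=; apply.
  exact: ltW.
by apply: IH => //; rewrite -ltnS; apply: leq_trans lt _.
Qed.

Lemma moebiusE (L : {fset T}) (x y : T) : y \in L ->
  moebius L x y =
    if x == y then 1
    else if (x < y)%O then - \sum_(z <- L | (x <= z < y)%O) moebius L x z
    else 0.
Proof.
move=> yL; have sub z : (#|` [fset t in L | (t <= z)%O]| <= #|` L|)%N.
  by apply: fsubset_leq_card; apply/fsubsetP => t; rewrite !inE => /andP[].
rewrite {1}/moebius (@moebius_rec_stable L x _ (#|` L|).+1) //=.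
exact: leqW.
Qed.

End Moebius.

Section Arrangements.
Context {R : realType} {n : nat}.
Local Open Scope classical_set_scope.

(* The empty subfamily has the whole space as intersection. *)
Definition inter (B : {fset set 'rV[R]_n}) : set 'rV[R]_n :=
  \bigcap_(H in [set H | H \in B]) H.

(* [^d] is the order dual of inclusion, i.e. reverse inclusion. *)
Definition int_poset (A : {fset set 'rV[R]_n}) : {fset (set 'rV[R]_n)^d} :=
  [fset (inter B : (set 'rV[R]_n)^d)
  | B in [fset B in fpowerset A | inter B != set0]].

(* The dimension of the subspace [U] with [X = x0 + U] *)
Definition affdim (X : set 'rV[R]_n) : nat :=
  \dim (xget 0%VS
    [set U : {vspace 'rV[R]_n} |
      exists x0, X = [set x | x - x0 \in U]]).

Definition charpoly (A : {fset set 'rV[R]_n}) : {poly int} :=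
  \sum_(X <- int_poset A)
    moebius (int_poset A) (setT : (set 'rV[R]_n)^d) X *: 'X^(affdim X).

Definition diff_hyp (s : R) (p : 'I_n * 'I_n) : set 'rV[R]_n :=
  [set x | x ord0 p.1 - x ord0 p.2 = s].

Definition catalan (m : nat) : {fset set 'rV[R]_n} :=
  ([fset diff_hyp 0 p | p in [pred p : 'I_n * 'I_n | (p.1 < p.2)%N]]
  `|` [fset diff_hyp s%:R p
      | s in iota 1 m, p in [pred p : 'I_n * 'I_n | p.1 != p.2]])%fset.

Definition deleted_catalan (m l : nat) (Gamma : rel 'I_n) :
    {fset set 'rV[R]_n} :=
  (catalan m
  `\` [fset diff_hyp l%:R p | p in [pred p : 'I_n * 'I_n | Gamma p.1 p.2]])%fset.

End Arrangements.

Arguments catalan R n m : clear implicits.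
Arguments deleted_catalan R {n} m l Gamma.

Section Digraphs.
Context {n : nat} (Gamma : rel 'I_n).

Definition is_matching (M : {set 'I_n * 'I_n}) : bool :=
  [forall a in M, Gamma a.1 a.2] &&
  [forall a in M, forall b in M,
     (a != b) ==> [disjoint [:: a.1; a.2] & [:: b.1; b.2]]].

Definition mat (k : nat) : nat :=
  #|[pred M : {set 'I_n * 'I_n} | is_matching M && (#|M| == k)]|.

(* A directed path is encoded by its vertex sequence, which determines it. *)
Definition is_dipath (p : seq 'I_n) : bool :=
  [&& p != [::], uniq p & sorted Gamma p].

(* Sequences of length at most [n] suffice, since paths repeat no vertex. *)
Definition is_path_cover (P : {set n.-bseq 'I_n}) : bool :=
  [&& [forall p in P, is_dipath p],
      [forall p in P, forall q in P, (p != q) ==> [disjoint p & q]]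
    & [forall v, exists p in P, v \in p]].

Definition paths (k : nat) : nat :=
  #|[pred P : {set n.-bseq 'I_n} | is_path_cover P && (#|P| == k)]|.

End Digraphs.

Definition falling {S : pzRingType} (x : S) (r : nat) : S :=
  \prod_(i < r) (x - i%:R).

Definition theta (n m l k : nat) : nat := ((m - l) * k + l * n + 1)%N.

(* Main.v *)
From HB Require Import structures.
Require Import Defs.
From mathcomp Require Import zify.
Import Order.TTheory GRing.Theory Num.Theory.
Set Implicit Arguments.
Unset Strict Implicit.
Unset Printing Implicit Defensive.
Local Open Scope ring_scope.

(** The proof is the finite field method followed by a count of configurations
of labelled points on a large discrete cycle.

Whitney's formula [charpoly_whitney] writes the characteristic polynomial as
an alternating sum of [t ^ dim] over the subfamilies of hyperplanes with
nonempty intersection.  A subfamily is a system of equations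
[x_i - x_j = s]; eliminating unknowns one at a time uses only additions and
subtractions, so the elimination is the same over the reals and over Z/q, up to
finitely many integers that have to stay nonzero modulo q
([solve_differences]).  Hence for every large q, prime or not, a consistent
system of dimension d has q ^ d solutions modulo q and an inconsistent one has
none, and inclusion-exclusion shows that the value of the characteristic
polynomial at q is the number of points of (Z/q)^n off all the hyperplanes
([finite_field_method]).

Such a point places n labelled particles on a cycle of length q, any two of
them more than m apart, except that j may stand exactly l steps after i when
(i, j) is an arc of Gamma.  The maximal runs of particles at successive
distance l are directed paths and form a path cover of Gamma, which the point
determines ([card_admissible]).  Two steps of length l make a distance 2l: if
2l > m this is allowed and every path cover occurs; if 2l <= m it is forbidden,
the runs have at most two particles, and such covers are the matchings of Gamma
([mat_small_covers]).

For a cover with k paths the runs are k rigid blocks, a path with r vertices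
reserving (r - 1) l + m + 1 consecutive cells.  Shrinking every block to one
cell turns the placements into injections of the k blocks into a shorter
cycle, so there are q (q - theta(k)) (q - theta(k) - 1) ... of them, with
k - 1 factors after q ([card_placements], [card_fits]).  Both sides of the
theorem are therefore polynomials that agree at all large integers. *)

(** * Counting tools and Whitney's formula *)

Lemma card_pred_bij (T U : finType) (P : pred T) (Q : pred U)
    (f : T -> U) (g : U -> T) :
  (forall x, P x -> Q (f x) /\ g (f x) = x) ->
  (forall y, Q y -> P (g y) /\ f (g y) = y) ->
  #|P| = #|Q|.
Proof.
move=> fP gQ; rewrite -(@card_in_imset _ _ f P); last first.
  by move=> x y /fP[_ fx] /fP[_ fy] e; rewrite -fx -fy e.
apply: eq_card => y; apply/imsetP/idP => [[x /fP[Qfx _] ->]//|Qy].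
by exists (g y); have [] := gQ y Qy.
Qed.

(** This is the expansion of the product over [C] of [1 - 1]. *)
Lemma sum_sign_subset (T : finType) (C : {set T}) :
  \sum_(B : {set T} | B \subset C) (-1) ^+ #|B| = (C == finset.set0)%:R :> int.
Proof.
have : \prod_i ((if i \in C then -1 else 0) + 1) = \sum_(B : {set T})
    \prod_i (if i \in B then (if i \in C then -1 else 0) else 1) :> int.
  by rewrite bigA_distr.
have -> : \prod_i ((if i \in C then -1 else 0) + 1 : int) = (C == finset.set0)%:R.
  have [->|/finset.set0Pn[c cC]] := eqVneq C finset.set0.
    by rewrite big1 // => i _; rewrite inE.
  by rewrite (bigD1 c) //= cC mul0r.
move=> ->; rewrite [RHS](bigID (fun B : {set T} => B \subset C)) /=.
rewrite [X in _ + X]big1 ?addr0 => [|B /fintype.subsetPn[b bB bC]]; last first.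
  by rewrite (bigD1 b) //= bB (negPf bC) mul0r.
apply: eq_bigr => B /fintype.subsetP BC; rewrite -big_mkcond /= -prodr_const.
by apply: eq_bigr => i /BC ->.
Qed.

Lemma big_fset_rem (V : nmodType) (T : choiceType) (L : {fset T}) (P : pred T)
    (f : T -> V) (y : T) : y \in L -> P y ->
  \sum_(z <- L | P z) f z = f y + \sum_(z <- L | P z && (z != y)) f z.
Proof.
move=> yL Py; rewrite big_mkcond (bigD1_seq y) ?fset_uniq //= Py -big_mkcondr.
by congr (_ + _); apply: eq_bigl => z; rewrite andbC.
Qed.

(** The summation property alone determines the Moebius function, by induction
along the order; this lets one guess the function instead of unfolding the
recursion. *)
Lemma moebius_unique (d : Order.disp_t) (T : porderType d) (L : {fset T})
    (b : T) (f : T -> int) :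
  b \in L -> (forall y, y \in L -> (b <= y)%O) ->
  (forall y, y \in L -> \sum_(z <- L | (z <= y)%O) f z = (y == b)%:R) ->
  forall y, y \in L -> moebius L b y = f y.
Proof.
move=> bL bmin fE y; have [k] := ubnP #|` [fset z in L | (z <= y)%O]%fset|.
elim: k y => // k IH y /ltnSE yk yL.
have := fE y yL; rewrite moebiusE // (@big_fset_rem _ _ _ _ _ y) // eq_sym.
have -> : \sum_(i <- L | (i <= y)%O && (i != y)) f i =
          \sum_(z <- L | (b <= z < y)%O) moebius L b z.
  rewrite big_seq_cond [RHS]big_seq_cond; apply: eq_big => z.
    by case zL: (z \in L) => //=; rewrite bmin //= lt_neqAle andbC.
  move=> /andP[zL zy]; rewrite IH //; apply: leq_trans yk.
  apply: fproper_ltn_card; rewrite fproperE; apply/andP; split.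
    apply/fsubsetP => t; rewrite !inE => /andP[-> /le_trans] /=; apply.
    by case/andP: zy.
  apply/fsubsetPn; exists y; rewrite !inE yL ?lexx //=.
  by rewrite andbC -lt_neqAle in zy; rewrite lt_geF.
rewrite [(b < y)%O]lt_neqAle bmin // andbT.
have [<- /(canRL (addrK _))|_ /(canRL (addrK _))] := eqVneq b y.
  by rewrite big1 ?subr0 // => z /andP[/le_lt_trans h /h]; rewrite ltxx.
by rewrite sub0r.
Qed.

Section Whitney.
Local Open Scope classical_set_scope.

Lemma le_setd (T : Type) (Y Z : (set T)^d) :
  (Y <= Z)%O <-> (Z : set T) `<=` (Y : set T).
Proof. by rewrite leEdual subsetEset. Qed.

Definition common (R : realType) (n : nat) (T : finType)
    (H : T -> set 'rV[R]_n) (B : {set T}) : set 'rV[R]_n :=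
  [set x | forall t, t \in B -> H t x].

(** The signed number of subfamilies with intersection [X] satisfies the
recursion of the Moebius function: summed over all [X] containing [Y] it counts
with signs all the subfamilies of the hyperplanes through [Y], which gives 0
unless no hyperplane contains [Y].  The indexing [H] of the arrangement may
list a hyperplane several times, since repetitions cancel as well. *)
Lemma charpoly_whitney (R : realType) (n : nat) (T : finType)
    (H : T -> set 'rV[R]_n) (S : {set T}) (A : {fset set 'rV[R]_n}) :
  (forall h, h \in A <-> exists2 t, t \in S & h = H t) ->
  (forall t, t \in S -> H t != setT) ->
  charpoly A =
    \sum_(B : {set T} | (B \subset S) && (common H B != set0))
       (-1) ^+ #|B| *: 'X^(affdim (common H B)).
Proof.
move=> AE HT.
pose L := int_poset A.
have LE X : reflect (exists B : {set T}, [/\ B \subset S, common H B != set0 & X = common H B])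
                    (X \in L).
  apply: (iffP idP) => [/imfsetP[C] | [B [BS BN ->]]].
    rewrite !inE fpowersetE /= => /andP[/fsubsetP CA CN] ->.
    exists [set t in S | H t \in C]%SET; suff <- : inter C = common H [set t in S | H t \in C]%SET.
      by split => //; apply/fintype.subsetP => t; rewrite inE => /andP[].
    apply/seteqP; split => x; first by move=> xC t; rewrite !inE => /andP[_ tC]; apply: xC.
    move=> xC h hC; have /AE[t tS hE] := CA h hC; rewrite hE; apply: xC.
    by rewrite inE tS -hE.
  have E : common H B = inter [fset H t | t in B]%fset.
    apply/seteqP; split => x.
      by move=> xB h /= /imfsetP[t /= tB ->]; apply: xB.
    by move=> xB t tB; apply: (xB (H t)) => /=; apply/imfsetP; exists t.
  apply/imfsetP; exists [fset H t | t in B]%fset => //=.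
  rewrite !inE fpowersetE -E BN andbT; apply/fsubsetP => h /imfsetP[t /= tB ->].
  by apply/AE; exists t => //; apply: (fintype.subsetP BS).
pose f (X : (set 'rV[R]_n)^d) : int :=
  \sum_(B : {set T} | (B \subset S) && (common H B == X)) (-1) ^+ #|B|.
have fE X : X \in L -> moebius L (setT : (set 'rV[R]_n)^d) X = f X.
  apply: moebius_unique.
  - apply/LE; exists finset.set0; rewrite finset.sub0set.
    have -> : common H finset.set0 = setT by apply/seteqP; split => x // _ t; rewrite inE.
    by split=> //; apply/set0P; exists 0.
  - by by move=> Y _; apply/le_setd.
  move=> Y YL.
  have [B0 [B0S B0N YE]] := LE _ YL.
  transitivity (\sum_(B : {set T} | B \subset [set t in S | `[< Y `<=` H t >]]%SET) (-1) ^+ #|B| : int).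
    rewrite /f (exchange_big_dep (fun B : {set T} => B \subset [set t in S | `[< Y `<=` H t >]]%SET)) /=.
      apply: eq_bigr => B /fintype.subsetP BY.
      have YB : Y `<=` common H B.
        by move=> x Yx t /BY; rewrite inE => /andP[_ /asboolP]; apply.
      rewrite (@big_fset_rem _ _ _ _ _ (common H B : (set 'rV[R]_n)^d)) //.
      - rewrite big1 ?addr0 // => Z.
        by rewrite eq_sym => /andP[/andP[_ /andP[_ /eqP->]]]; rewrite eqxx.
      - apply/LE; exists B; split=> //.
          by apply/fintype.subsetP => t /BY; rewrite inE => /andP[].
        move/set0P: B0N => [x]; rewrite -YE => /YB xB; by apply/set0P; exists x.
      rewrite eqxx andbT; apply/andP; split.
        exact/le_setd.
      by apply/fintype.subsetP => t /BY; rewrite inE => /andP[].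
    move=> Z B ZY /andP[/fintype.subsetP BS /eqP BZ]; apply/fintype.subsetP => t tB.
    rewrite inE BS //=; apply/asboolP => x Yx.
    have : common H B x.
      by rewrite BZ; move/le_setd: ZY; apply.
    by apply.
  (* no hyperplane contains Y exactly when Y is the whole space *)
  rewrite sum_sign_subset; congr (_%:R); congr nat_of_bool.
  apply/eqP/eqP => [C0|YT]; last first.
    apply/setP => t; rewrite !inE; apply/negP => /andP[tS /asboolP].
    by rewrite YT => tT; case/negP: (HT t tS); apply/eqP/seteqP.
  rewrite YE; apply/seteqP; split => x // _ t tB.
  have : t \in [set t in S | `[< Y `<=` H t >]]%SET.
    rewrite inE (fintype.subsetP B0S) //=; apply/asboolP; rewrite YE => z; exact.
  by rewrite C0 inE.
rewrite /charpoly -/L big_seq_cond.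
under eq_bigr => X /andP[XL _] do rewrite fE // scaler_suml.
rewrite -big_seq_cond (exchange_big_dep (fun B : {set T} => (B \subset S))) /=; last first.
  by move=> X B _ /andP[].
rewrite [RHS]big_mkcondr /=; apply: eq_bigr => B BS; rewrite BS.
case: ifPn => [BN|]; last first.
  rewrite negbK => /eqP B0; rewrite big_seq_cond big1 // => X /andP[/LE[C [_ CN ->]]].
  by rewrite B0 => /eqP CE; rewrite -CE eqxx in CN.
rewrite (@big_fset_rem _ _ _ _ _ (common H B : (set 'rV[R]_n)^d)) //.
  by rewrite big1 ?addr0 // => Z; rewrite eq_sym => /andP[/eqP->]; rewrite eqxx.
  by apply/LE; exists B.
by rewrite eqxx.
Qed.

End Whitney.

(** * Systems of difference equations *)

(** The edge [((i, j), s)] of a gain graph, read as an equation in a group [G]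
where [u] stands for the unit length. *)
Definition solves n (G : zmodType) (u : G) (x : 'I_n -> G)
    (t : 'I_n * 'I_n * nat) : Prop :=
  x t.1.1 = x t.1.2 + u *+ t.2.

(** Elimination, uniformly in the group: [r] sends an unknown to the free unknown
that represents it and [o] is its offset.  An equation between two classes
merges them; an equation inside a class is either redundant or forces
[u *~ d = 0] for a nonzero integer [d], which is impossible over the reals and
modulo any integer larger than [d]. *)
Lemma solve_differences n (E : seq ('I_n * 'I_n * nat)) :
  (exists r : 'I_n -> 'I_n, exists o : 'I_n -> int,
     [/\ forall i, r (r i) = r i, forall i, o (r i) = 0 &
         forall (G : zmodType) (u : G) x,
           (forall t, t \in E -> solves u x t) <->
           (forall i, x i = x (r i) + u *~ o i)])
  \/ (exists2 d : int, d != 0 &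
      forall (G : zmodType) (u : G) x,
        (forall t, t \in E -> solves u x t) -> u *~ d = 0).
Proof.
elim: E => [|[[i j] s] E [[r [o [rr o0 sol]]]|[d d0 hd]]].
- left; exists id, (fun=> 0); split=> // G u x.
  by split=> // _ i; rewrite mulr0z addr0.
- have consP (G : zmodType) (u : G) x :
    (forall t, t \in (i, j, s) :: E -> solves u x t) <->
    solves u x (i, j, s) /\ (forall k, x k = x (r k) + u *~ o k).
    rewrite -sol; split=> [h|[h1 h2] t].
      by split=> [|t tE]; apply: h; rewrite inE ?eqxx // tE orbT.
    by rewrite inE => /orP[/eqP->|/h2].
  (* the offset that the new equation prescribes between the representatives *)
  pose d : int := o j + s%:Z - o i.
  have eqn (G : zmodType) (u : G) x : (forall k, x k = x (r k) + u *~ o k) ->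
      solves u x (i, j, s) <-> x (r i) = x (r j) + u *~ d.
    move=> h; rewrite /solves /= (h i) (h j) /d mulrzBr mulrzDr pmulrn.
    split=> [/(canRL (addrK _)) ->|->]; first by rewrite !addrA.
    by rewrite !addrA subrK.
  have [rij|rij] := eqVneq (r i) (r j).
    have [d0|d0] := eqVneq d 0.
      left; exists r, o; split=> // G u x; rewrite consP; split=> [[]//|h].
      by split=> //; apply/eqn => //; rewrite rij d0 mulr0z addr0.
    right; exists d => // G u x /consP[h1 h2].
    by move/(eqn _ _ _ h2): h1; rewrite rij => e; apply: (addrI (x (r j))); rewrite addr0 -e.
  left; exists (fun k => if r k == r i then r j else r k),
               (fun k => if r k == r i then o k + d else o k); split.
  + move=> k; case: (eqVneq (r k) (r i)) => [_|ki].
      by rewrite rr eq_sym (negPf rij).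
    by rewrite rr (negPf ki).
  + move=> k; case: (eqVneq (r k) (r i)) => [_|ki].
      by rewrite rr eq_sym (negPf rij).
    by rewrite rr (negPf ki).
  + move=> G u x; rewrite consP; split=> [[h1 h2] k|h].
      move/(eqn _ _ _ h2): h1 => h1.
      case: eqP => [ki|_]; last exact: h2.
      by rewrite {1}h2 ki h1 mulrzDr -!addrA [_ *~ d + _]addrC.
    have hi : x (r i) = x (r j) + u *~ d by rewrite {1}h rr eqxx o0 add0r.
    have h2 k : x k = x (r k) + u *~ o k.
      rewrite {1}h; case: eqP => [->|//].
      by rewrite hi mulrzDr -!addrA [_ *~ d + _]addrC.
    by split=> //; apply/eqn.
- right; exists d => // G u x h; apply: (hd _ _ x) => t tE; apply: h.
  by rewrite inE tE orbT.
Qed.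

Lemma card_param_solutions n (G : finZmodType) (u : G) (r : 'I_n -> 'I_n)
    (o : 'I_n -> int) :
  (forall i, r (r i) = r i) -> (forall i, o (r i) = 0) ->
  #|[pred x : {ffun 'I_n -> G} | [forall i, x i == x (r i) + u *~ o i]]| =
  (#|G| ^ #|[pred i | r i == i]|)%N.
Proof.
move=> rr o0.
have rP i : r (r i) == r i by rewrite rr.
transitivity #|{ffun {i | r i == i} -> G}|; last first.
  by rewrite card_ffun card_sig.
apply: (@card_pred_bij _ _ _ _
  (fun x : {ffun 'I_n -> G} => [ffun i : {i | r i == i} => x (val i)])
  (fun y : {ffun {i | r i == i} -> G} =>
     [ffun i => y (exist _ (r i) (rP i)) + u *~ o i])).
- move=> x /forallP h; split=> //; apply/ffunP => i; rewrite !ffunE /=.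
  by rewrite -(eqP (h i)).
- move=> y _; split.
    apply/forallP => i; rewrite !ffunE o0 mulr0z addr0; apply/eqP; congr (y _ + _).
    by apply/val_inj; rewrite /= rr.
  apply/ffunP => -[i ri]; rewrite !ffunE /=.
  have -> : o i = 0 by rewrite -(eqP ri) o0.
  by rewrite mulr0z addr0; congr (y _); apply/val_inj; apply/eqP.
Qed.

Section AffDim.
Local Open Scope classical_set_scope.

Lemma affdim_param (R : realType) n (r : 'I_n -> 'I_n) (o : 'I_n -> int) :
  (forall i, r (r i) = r i) -> (forall i, o (r i) = 0) ->
  let X := [set x : 'rV[R]_n | forall i, x ord0 i = x ord0 (r i) + 1 *~ o i] in
  X !=set0 /\ affdim X = #|[pred i | r i == i]|.
Proof.
move=> rr o0 X.
have rP i : r (r i) == r i by rewrite rr.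
pose c i : {i | r i == i} := exist _ (r i) (rP i).
pose x0 : 'rV[R]_n := \row_i (1 *~ o i).
have Xx0 : X x0 by move=> i; rewrite !mxE o0 mulr0z add0r.
split; first by exists x0.
pose k := #|{: {i | r i == i}}|.
pose f (y : 'rV[R]_k) : 'rV[R]_n := \row_i y ord0 (enum_rank (c i)).
have f_lin : linear f by move=> a y z; apply/rowP => i; rewrite !mxE.
pose fL : {linear 'rV[R]_k -> 'rV[R]_n} :=
  HB.pack f (GRing.isLinear.Build R 'rV[R]_k 'rV[R]_n *:%R f f_lin).
(* the solutions form a translate of the image of the injective map f *)
have XE (x : 'rV[R]_n) : X x <-> x - x0 \in limg (linfun fL).
  split=> [Xx|/memv_imgP[y _ xy] i].
    apply/memv_imgP; exists (\row_j x ord0 (val (enum_val j))); first exact: memvf.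
    rewrite lfunE /=; apply/rowP => i; rewrite !mxE enum_rankK /=.
    by rewrite (Xx i) addrK.
  have E j : x ord0 j = y ord0 (enum_rank (c j)) + 1 *~ o j.
    by move/rowP/(_ j): xy; rewrite lfunE /= !mxE => /(canRL (subrK _)).
  rewrite E [in RHS]E o0 mulr0z addr0; congr (y _ (enum_rank _) + _).
  by apply/val_inj; rewrite /= rr.
rewrite /affdim; case: xgetP => [V _ [y0 XV]|/(_ (limg (linfun fL)))]; last first.
  by case; exists x0; apply/seteqP; split => x /XE.
have XV' x : X x <-> x - y0 \in V by rewrite XV.
have -> : V = limg (linfun fL).
  have Xy0 : X y0 by apply/XV'; rewrite subrr mem0v.
  apply/vspaceP => v; apply/idP/idP => [vV|vU].
    have /XE h : X (y0 + v) by apply/XV'; rewrite addrC addrA addNr add0r.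
    by have := memvB h (iffLR (XE _) Xy0); rewrite opprB addrA subrK addrAC subrr add0r.
  have /XV' h : X (x0 + v) by apply/XE; rewrite addrC addrA addNr add0r.
  by have := memvB h (iffLR (XV' _) Xx0); rewrite opprB addrA subrK addrAC subrr add0r.
rewrite limg_dim_eq.
  by rewrite dimvf /dim /= mul1n /k card_sig.
apply/eqP; rewrite -subv0; apply/subvP => y; rewrite memv_cap memvf memv_ker (lfunE fL) /=.
move=> /eqP fy; rewrite memv0; apply/eqP/rowP => j.
have [[i ri] ij] : exists i, j = enum_rank i by exists (enum_val j); rewrite enum_valK.
move/rowP/(_ i): fy; rewrite !mxE ij => <-; congr (y _ (enum_rank _)).
by apply/val_inj => /=; rewrite (eqP ri).
Qed.

End AffDim.

(** * The finite field method *)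

Section FiniteField.
Variables (R : realType) (n : nat) (T : finType) (e : T -> 'I_n * 'I_n * nat).

Let H (t : T) : set 'rV[R]_n := diff_hyp (e t).2%:R (e t).1.

(** The hyperplane [x_i - x_j = s] is reduced to [x_j = x_i + s], that is with
unit length -1: this makes the points of a path of Gamma run forward around the
cycle and does not change any count. *)
Definition solution_mod q (t : T) (x : {ffun 'I_n -> 'I_q.+2}) : bool :=
  x (e t).1.2 == x (e t).1.1 + (e t).2%:R.

Lemma card_solutions_mod (B : {set T}) : exists q0, forall q, (q0 <= q)%N ->
  #|[pred x : {ffun 'I_n -> 'I_q.+2} | [forall t in B, solution_mod t x]]| =
  (if common H B != classical_sets.set0 then q.+2 ^ affdim (common H B) else 0)%N.
Proof.
have HE (x : 'rV[R]_n) t : H t x <-> solves 1 (x ord0) (e t).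
  rewrite /H /diff_hyp /solves /=.
  by split=> [<-|->]; rewrite addrC ?subrK ?addKr.
have ME q (x : {ffun 'I_n -> 'I_q.+2}) t :
    solution_mod t x <-> solves (-1) x (e t).
  rewrite /solves /solution_mod mulNrn.
  by split=> [/eqP->|->]; rewrite ?addrK ?subrK.
have mapP' (P : 'I_n * 'I_n * nat -> Prop) :
    (forall t, t \in [seq e t | t <- enum B] -> P t) <-> (forall t, t \in B -> P (e t)).
  split=> [h t tB|h t0 /mapP[t tB ->]]; last by apply: h; rewrite -mem_enum.
  by apply/h/map_f; rewrite mem_enum.
have [[r [o [rr o0 sol]]]|[d d0 hd]] := solve_differences [seq e t | t <- enum B].
- have [XN Xdim] := affdim_param R rr o0; exists 0%N => q _.
  have CE : common H B =
      [set x : 'rV[R]_n | forall i, x ord0 i = x ord0 (r i) + 1 *~ o i]%classic.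
    apply/seteqP; split => x /=.
      by move=> h; apply/sol/mapP' => t tB; apply/HE/h.
    by move=> /sol/mapP' h t tB; apply/HE/h.
  rewrite CE Xdim -CE.
  have -> : common H B != classical_sets.set0.
    apply/set0P; have [x hx] := XN; exists x => t tB; apply/HE.
    by move: t tB; apply/mapP'/sol.
  rewrite -[in RHS](card_ord q.+2) -(card_param_solutions (-1 : 'I_q.+2) rr o0).
  apply: eq_card => x; rewrite !inE.
  apply/'forall_implyP/forallP => [h i|h t tB].
    by apply/eqP; move: i; apply/sol/mapP' => t tB; apply/ME/h.
  by apply/ME; move: t tB; apply/mapP'/sol => i; apply/eqP.
- exists `|d|%N => q qd.
  case: ifPn => [/set0P[x hx]|_].
    have : forall t, t \in [seq e t | t <- enum B] -> solves 1 (x ord0) t.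
      by apply/mapP' => t tB; apply/HE/hx.
    by move/hd/eqP; rewrite intr_eq0 (negPf d0).
  apply: eq_card0 => x; apply/negP => /'forall_implyP h.
  have : forall t, t \in [seq e t | t <- enum B] -> solves (-1) x t.
    by apply/mapP' => t tB; apply/ME/h.
  have small k : (0 < k <= q)%N -> k%:R != 0 :> 'I_q.+2.
    move=> /andP[k0 kq]; apply/eqP => /(congr1 val) /=.
    by rewrite Zp_nat /= modn_small; lia.
  move/hd/eqP; rewrite mulNrz oppr_eq0; apply/negP.
  case: d d0 qd {hd} => k d0 kq; first by apply: small; lia.
  by rewrite NegzE mulrNz oppr_eq0; apply: (small k.+1); lia.
Qed.

(** No primality is required of the modulus, because the elimination of
[solve_differences] never divides. *)
Theorem finite_field_method (S : {set T}) (A : {fset set 'rV[R]_n}) :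
  (forall h, h \in A <-> exists2 t, t \in S & h = H t) ->
  (forall t, t \in S -> (e t).1.1 != (e t).1.2) ->
  exists q0, forall q, (q0 <= q)%N ->
    (charpoly A).[q.+2%:R] =
    #|[pred x : {ffun 'I_n -> 'I_q.+2} | [forall t in S, ~~ solution_mod t x]]|%:R.
Proof.
move=> AE eS.
have /choice[q0 q0P] := card_solutions_mod.
(* a threshold that is valid for all the subfamilies at once *)
exists (\max_(B : {set T}) q0 B) => q qq0.
rewrite (charpoly_whitney AE); last first.
  move=> t /eS e12; apply/eqP => /seteqP[_] /(_ (\row_i ((i == (e t).1.1)%:R * (1 + (e t).2%:R))) I).
  rewrite /H /diff_hyp /= !mxE eqxx eq_sym (negPf e12) mul1r mul0r subr0.
  by rewrite -[RHS]add0r => /addIr/eqP; rewrite oner_eq0.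
rewrite horner_sum [LHS]big_mkcondr /=.
transitivity (\sum_(B : {set T} | B \subset S)
   \sum_(x : {ffun 'I_n -> 'I_q.+2} | [forall t in B, solution_mod t x]) (-1) ^+ #|B| : int).
  apply: eq_bigr => B BS; rewrite sumr_const.
  transitivity ((-1) ^+ #|B| *+
     #|[pred x : {ffun 'I_n -> 'I_q.+2} | [forall t in B, solution_mod t x]]| : int) => //.
  rewrite q0P ?(leq_trans _ qq0) ?leq_bigmax //.
  case: ifP => _; last by rewrite mulr0n.
  by rewrite hornerZ hornerXn -natrX mulr_natr.
rewrite (exchange_big_dep xpredT) //= -sum1_card natr_sum [RHS]big_mkcond /=.
apply: eq_bigr => x _.
transitivity (\sum_(B : {set T} | B \subset [set t in S | solution_mod t x]%SET) (-1) ^+ #|B| : int).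
  apply: eq_bigl => B; apply/andP/fintype.subsetP => [[/fintype.subsetP BS /'forall_implyP Bx] t tB|h].
    by rewrite inE BS //= Bx.
  split; first by apply/fintype.subsetP => t /h; rewrite inE => /andP[].
  by apply/'forall_implyP => t /h; rewrite inE => /andP[].
rewrite sum_sign_subset; case: eqP => [C0|C0].
  rewrite ifT //; apply/'forall_implyP => t tS.
  by move/setP/(_ t): C0; rewrite !inE tS /= => ->.
rewrite ifF //; apply/negP => /'forall_implyP h; case: C0; apply/setP => t.
by rewrite !inE; apply/negP => /andP[/h/negPf ->].
Qed.
End FiniteField.

(** * Placing labelled blocks on a cycle *)

(** The number of steps from [x] forward to [y] around a cycle with [q.+1] cells. *)
Definition cgap q (x y : 'I_q.+1) : nat := (y - x)%R.

Lemma cgapE q (x y : 'I_q.+1) :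
  cgap x y = (if x <= y then y - x else q.+1 + y - x)%N.
Proof.
have := ltn_ord x; have := ltn_ord y; rewrite /cgap => hy hx /=; rewrite modnDmr.
case: leqP => xy.
  have -> : (y + (q.+1 - x) = (y - x) + q.+1)%N by lia.
  by rewrite modnDr modn_small //; lia.
by rewrite modn_small; lia.
Qed.

Section Placement.
Variables (K : finType) (k0 : K).

(** Block [i] starts at [y i] and occupies [a i] cells; on the cycle, the blocks
are disjoint when no block starts inside another one. *)
Definition on_cycle q (a : K -> nat) (y : {ffun K -> 'I_q.+1}) : bool :=
  [forall i, forall j, (i != j) ==> (a i <= cgap (y i) (y j))%N].

(** The same placements cut open at the start of the block [k0], which is put in
the cell 0. *)
Definition on_line q (a : K -> nat) (y : {ffun K -> 'I_q.+1}) : bool :=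
  [&& y k0 == 0, [forall i, (y i + a i <= q.+1)%N] &
    [forall i, forall j, (i != j) ==> (y i + a i <= y j)%N || (y j + a j <= y i)%N]].

(** Rotating a placement puts the block [k0] in the cell 0. *)
Lemma card_on_cycle q a :
  #|on_cycle a : pred {ffun K -> 'I_q.+1}| =
  (q.+1 * #|[pred y : {ffun K -> 'I_q.+1} | on_cycle a y & y k0 == 0%R]|)%N.
Proof.
transitivity #|[predX 'I_q.+1 & [pred y : {ffun K -> 'I_q.+1} | on_cycle a y & y k0 == 0]]|;
  last by rewrite cardX card_ord.
apply: (@card_pred_bij _ _ _ _
  (fun y : {ffun K -> 'I_q.+1} => (y k0, [ffun i => y i - y k0]))
  (fun z : 'I_q.+1 * {ffun K -> 'I_q.+1} => [ffun i => z.2 i + z.1])).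
- move=> y cy; split; last by apply/ffunP => i; rewrite !ffunE subrK.
  rewrite !inE /= ffunE subrr eqxx andbT.
  apply/forallP => i; apply/forallP => j; apply/implyP => ij.
  rewrite /cgap !ffunE opprB addrA subrK.
  by move/forallP/(_ i)/forallP/(_ j)/implyP: cy; apply.
- move=> [c z]; rewrite !inE /= => /andP[cz /eqP z0]; split.
    apply/forallP => i; apply/forallP => j; apply/implyP => ij.
    rewrite /cgap !ffunE opprD addrACA subrr addr0.
    by move/forallP/(_ i)/forallP/(_ j)/implyP: cz; apply.
  by rewrite ffunE z0 add0r; congr pair; apply/ffunP => i; rewrite !ffunE addrK.
Qed.

(** A block cannot run past the end of the line, because on the cycle it would
enter the block [k0]. *)
Lemma on_cycle_line q a (y : {ffun K -> 'I_q.+1}) :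
  (forall i, 0 < a i)%N -> (a k0 <= q.+1)%N ->
  on_line a y = on_cycle a y && (y k0 == 0%R).
Proof.
move=> a0 ak; rewrite /on_line andbC; case: eqP => [y0|]; rewrite ?andbF ?andbT //=.
have y0' : y k0 = 0%N :> nat by rewrite y0.
apply/andP/forallP => [[/forallP hq hd] i|hc].
  apply/forallP => j; apply/implyP => ij; rewrite cgapE.
  move/forallP/(_ i)/forallP/(_ j)/implyP/(_ ij): hd.
  by have := hq i; have := hq j; have := a0 i; have := a0 j; case: ifP; lia.
split; last first.
  apply/forallP => i; apply/forallP => j; apply/implyP => ij.
  move/forallP/(_ j)/implyP/(_ ij): (hc i); rewrite cgapE.
  have ji : j != i by rewrite eq_sym.
  move/forallP/(_ i)/implyP/(_ ji): (hc j); rewrite cgapE.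
  by have := ltn_ord (y i); have := ltn_ord (y j); have := a0 i; have := a0 j;
    case: ifP; case: ifP; lia.
apply/forallP => i; have [->|ik] := eqVneq i k0; first by rewrite y0'.
move/forallP/(_ k0)/implyP/(_ ik): (hc i); rewrite cgapE y0'.
have := a0 i; have := ltn_ord (y i); case: ifP; lia.
Qed.

(** A block of length at least 2 can lose its second cell: every block that
starts later moves back by one, and since the order of the blocks does not change,
the cell can be put back. *)
Lemma card_on_line_shrink q a i : (1 < a i)%N -> (forall j, 0 < a j)%N ->
  #|on_line a : pred {ffun K -> 'I_q.+2}| =
  #|on_line (fun j => a j - (j == i))%N : pred {ffun K -> 'I_q.+1}|.
Proof.
move=> ai a0.
apply: (@card_pred_bij _ _ _ _
  (fun y : {ffun K -> 'I_q.+2} => [ffun j => inord (y j - (y i < y j))%N : 'I_q.+1])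
  (fun y : {ffun K -> 'I_q.+1} => [ffun j => inord (y j + (y i < y j))%N : 'I_q.+2])).
- move=> y; change {ffun K -> 'I_q.+2} in (type of y); move=> /and3P[/eqP y0 /forallP yq /forallP yd].
  have y0' : y k0 = 0%N :> nat by rewrite y0.
  have yd' j h : j != h -> (y j + a j <= y h)%N || (y h + a h <= y j)%N.
    by move/forallP: (yd j) => /(_ h)/implyP.
  have b j : (y j - (y i < y j) < q.+1)%N.
    have := yq j; have := a0 j; have := yq i; case: (eqVneq j i) => [->|/yd']; lia.
  have e j : (inord (y j - (y i < y j))%N : 'I_q.+1) = (y j - (y i < y j))%N :> nat.
    by rewrite inordK.
  split; last first.
    apply/ffunP => j; apply/val_inj; rewrite !ffunE /= !e inordK;
    have := ltn_ord (y j); have := a0 j;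
    case: (eqVneq j i) => [->|/yd']; rewrite ?eqxx; lia.
  apply/and3P; split.
  + by apply/eqP/val_inj; rewrite ffunE /= e y0' sub0n.
  + apply/forallP => j; rewrite !ffunE e.
    have := yq j; have := yq i; have := a0 j.
    case: (eqVneq j i) => [->|/yd']; lia.
  + apply/forallP => j; apply/forallP => h; apply/implyP => jh; rewrite !ffunE !e.
    have := yd' _ _ jh; have := a0 j; have := a0 h.
    case: (eqVneq j i) jh => [->|/yd'] jh; case: (eqVneq h i) jh => [->|/yd'] jh; lia.
- move=> y; change {ffun K -> 'I_q.+1} in (type of y); move=> /and3P[/eqP y0 /forallP yq /forallP yd].
  have y0' : y k0 = 0%N :> nat by rewrite y0.
  have yd' j h : j != h -> (y j + (a j - (j == i)) <= y h)%N || (y h + (a h - (h == i)) <= y j)%N.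
    by move/forallP: (yd j) => /(_ h)/implyP.
  have e j : (inord (y j + (y i < y j))%N : 'I_q.+2) = (y j + (y i < y j))%N :> nat.
    by rewrite inordK //; have := ltn_ord (y j); lia.
  split; last first.
    apply/ffunP => j; apply/val_inj; rewrite !ffunE /= !e inordK;
    have := ltn_ord (y j); have := a0 j;
    case: (eqVneq j i) => [->|/yd']; rewrite ?eqxx; lia.
  apply/and3P; split.
  + by apply/eqP/val_inj; rewrite ffunE /= e y0'.
  + apply/forallP => j; rewrite !ffunE e.
    have := yq j; have := yq i; have := a0 j; rewrite eqxx.
    case: (eqVneq j i) => [->|/yd']; rewrite ?eqxx; lia.
  + apply/forallP => j; apply/forallP => h; apply/implyP => jh; rewrite !ffunE !e.
    have := yd' _ _ jh; have := a0 j; have := a0 h.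
    case: (eqVneq j i) jh => [->|/yd'] jh; case: (eqVneq h i) jh => [->|/yd'] jh;
      rewrite ?eqxx in jh * => //; lia.
Qed.

(** Once all the blocks have length 1 the placements are the injections, and these
are counted by reading [card_on_cycle] backwards. *)
Lemma card_on_line q a : (forall j, 0 < a j)%N -> (\sum_j (a j).-1 <= q)%N ->
  #|on_line a : pred {ffun K -> 'I_q.+1}| =
  ((q - \sum_j (a j).-1) ^_ #|K|.-1)%N.
Proof.
have [N] := ubnP (\sum_j (a j).-1); elim: N q a => // N IH q a /ltnSE aN a0 aq.
have [/existsP[i ai]|/existsPn a1] := boolP [exists i, 1 < a i]%N.
  have sE : (\sum_j (a j - (j == i)%N).-1).+1 = (\sum_j (a j).-1)%N.
    rewrite (bigD1 i) //= [in RHS](bigD1 i) //= eqxx.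
    rewrite [X in (_ + X).+1](eq_bigr (fun j => (a j).-1)).
      by move: (\sum_(j | _) _)%N => s; lia.
    by move=> j /negPf->; rewrite subn0.
  case: q aq => [|q] aq; first by lia.
  rewrite (card_on_line_shrink _ ai) // IH; [|lia| |lia].
    by congr (_ ^_ _); lia.
  by move=> j; have := a0 j; case: eqP => [->|]; lia.
(* the base case: one cell per block *)
have aE j : a j = 1%N by have := a0 j; have := a1 j; lia.
have -> : (\sum_j (a j).-1)%N = 0%N by rewrite big1 // => j _; rewrite aE.
rewrite subn0; apply/eqP; rewrite -(eqn_pmul2l (ltn0Sn q)); apply/eqP.
transitivity #|on_cycle a : pred {ffun K -> 'I_q.+1}|.
  rewrite card_on_cycle; congr (_ * _)%N; apply: eq_card => y.
  by rewrite !inE -on_cycle_line // aE.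
transitivity (q.+1 ^_ #|K|)%N; last first.
  by rewrite (cardD1 k0) inE /= add1n ffactnS.
rewrite -[in RHS](card_ord q.+1) -card_inj_ffuns cardsE; apply: eq_card => y.
rewrite unfold_in [RHS]unfold_in; apply/forallP/injectiveP => [hy i j yij|yi i].
  apply/eqP/negPn/negP => ij; move/forallP/(_ j)/implyP/(_ ij): (hy i).
  by rewrite yij /cgap subrr aE.
apply/forallP => j; apply/implyP => /eqP ij; rewrite aE lt0n; apply/negP => /eqP e.
by apply/ij/esym/yi/eqP; rewrite -subr_eq0; apply/eqP/val_inj.
Qed.

Lemma card_placements q a : (forall j, 0 < a j)%N ->
  (\sum_j (a j).-1 <= q)%N ->
  #|on_cycle a : pred {ffun K -> 'I_q.+1}| =
  (q.+1 * (q - \sum_j (a j).-1) ^_ #|K|.-1)%N.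
Proof.
move=> a0 aq; have ak : (a k0 <= q.+1)%N.
  by move: aq; rewrite (bigD1 k0) //=; have := a0 k0; lia.
rewrite card_on_cycle -card_on_line //; congr (_ * _)%N.
by apply: eq_card => y; rewrite !inE -on_cycle_line.
Qed.

End Placement.

(** * Configurations modulo q and path covers *)

Lemma natr_ord_inj q a b : (a <= q.+1)%N -> (b <= q.+1)%N ->
  a%:R = b%:R :> 'I_q.+2 -> a = b.
Proof.
by move=> aq bq /(congr1 val); rewrite !Zp_nat /= !modn_small.
Qed.

Lemma cgap_natr q (x : 'I_q.+2) s : (s <= q.+1)%N -> cgap x (x + s%:R) = s.
Proof. by move=> sq; rewrite /cgap addrC addKr Zp_nat /= modn_small. Qed.

Lemma cgapK q (x y : 'I_q.+2) : y = x + (cgap x y)%:R.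
Proof. by rewrite /cgap natr_Zp addrC subrK. Qed.

Section PathCovers.
Variables (n : nat) (Gamma : rel 'I_n).

Lemma path_coverP (P : {set n.-bseq 'I_n}) :
  reflect [/\ forall p : n.-bseq 'I_n, p \in P -> is_dipath Gamma p,
              forall (p p' : n.-bseq 'I_n) v, p \in P -> p' \in P -> v \in p -> v \in p' -> p = p' &
              forall v, exists2 p : n.-bseq 'I_n, p \in P & v \in p]
          (is_path_cover Gamma P).
Proof.
apply: (iffP and3P) => [[/'forall_implyP h1 /'forall_implyP h2 /forallP h3]|[h1 h2 h3]].
  split=> // [p p' v pP p'P vp vp'|v]; last first.
    by have /'exists_andP[p []] := h3 v; exists p.
  apply/eqP/negPn/negP => pp'.
  have /'forall_implyP/(_ p' p'P)/implyP/(_ pp') := h2 p pP.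
  by move=> d; have := disjointFr d vp; rewrite vp'.
split; first by apply/'forall_implyP.
  apply/'forall_implyP => p pP; apply/'forall_implyP => p' p'P; apply/implyP => pp'.
  rewrite disjoint_subset; apply/fintype.subsetP => v vp; rewrite inE.
  by apply: contra pp' => vp'; apply/eqP; apply: h2 vp vp'.
by apply/forallP => v; have [p pP vp] := h3 v; apply/'exists_andP; exists p.
Qed.

(** Double counting of the incidences between vertices and paths. *)
Lemma sum_size_path_cover (P : {set n.-bseq 'I_n}) :
  is_path_cover Gamma P -> (\sum_(p in P) size p = n)%N.
Proof.
case/path_coverP => h1 h2 h3.
transitivity (\sum_(p in P) \sum_(v < n | v \in p) 1)%N.
  apply: eq_bigr => p /h1 /and3P[_ pu _].
  by rewrite sum1_card; apply/esym/card_uniqP.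
rewrite (exchange_big_dep xpredT) //=.
transitivity (\sum_(v < n) 1)%N; last by rewrite sum1_card card_ord.
apply: eq_bigr => v _; have [p pP vp] := h3 v.
rewrite (bigD1 p) /=; last by rewrite pP vp.
rewrite big1 ?addn0 // => p' /andP[/andP[p'P vp'] /eqP[]].
exact: h2 vp' vp.
Qed.

Lemma card_path_cover (P : {set n.-bseq 'I_n}) :
  is_path_cover Gamma P -> (#|P| <= n)%N.
Proof.
move=> cP; rewrite -[n in (_ <= n)%N](sum_size_path_cover cP) -sum1_card.
by apply: leq_sum => p; case/path_coverP: cP => h1 _ _ /h1 /and3P[]; case: (val p).
Qed.

End PathCovers.

Section Configurations.
Variables (n : nat) (v0 : 'I_n) (Gamma : rel 'I_n) (m l q : nat).
Hypotheses (l_gt0 : (0 < l)%N) (l_le_m : (l <= m)%N).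
Hypothesis q_large : (n.+1 * l + m <= q)%N.

Implicit Types (x : {ffun 'I_n -> 'I_q.+2}) (p : seq 'I_n).

(** The points of (Z/q)^n that avoid the deleted arrangement. *)
Definition admissible x : bool :=
  [forall i, forall j, (i != j) ==> (cgap (x i) (x j) <= m)%N ==>
     (cgap (x i) (x j) == l) && Gamma i j].

Definition step x : rel 'I_n := fun i j => x j == x i + l%:R.

Definition maximal_chain x p : bool :=
  [&& p != [::], sorted (step x) p,
      [forall w, ~~ step x w (head v0 p)] & [forall w, ~~ step x (last v0 p) w]].

(** The cells reserved by a run [p]: those from its first to its last point, and
the [m] cells after it that no other run may enter. *)
Definition width p : nat := ((size p).-1 * l + m.+1)%N.

Definition fits x (P : {set n.-bseq 'I_n}) : bool :=
  [forall p in P, sorted (step x) p] &&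
  [forall p in P, forall p' in P, (p != p') ==>
     (width p <= cgap (x (head v0 p)) (x (head v0 p')))%N].

(** The covers that actually occur: when 2l <= m a third vertex on a path would be
too close to the first one. *)
Definition good_cover (P : {set n.-bseq 'I_n}) : bool :=
  is_path_cover Gamma P && ((m < l.*2)%N || [forall p in P, size p <= 2]%N).

Lemma chain_pos x p t : sorted (step x) p -> (t < size p)%N ->
  x (nth v0 p t) = x (head v0 p) + (t * l)%:R.
Proof.
move=> /(sortedP v0) sp; elim: t => [|t IH] tp.
  by rewrite nth0 mul0n addr0.
by rewrite (eqP (sp _ tp)) IH 1?ltnW // mulSnr natrD addrA.
Qed.

Lemma chain_uniq x p : sorted (step x) p -> (size p <= n.+1)%N -> uniq p.
Proof.
move=> sp pn; apply/(uniqP v0) => i j; rewrite !inE => /= ip jp ij.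
have {}ip : (i < size p)%N := ip; have {}jp : (j < size p)%N := jp.
have := chain_pos sp ip; rewrite ij (chain_pos sp jp) => /addrI e.
have il : (i * l <= n.+1 * l)%N by rewrite leq_mul2r; lia.
have jl : (j * l <= n.+1 * l)%N by rewrite leq_mul2r; lia.
have /esym/eqP : (j * l = i * l)%N by apply: natr_ord_inj e; lia.
by rewrite eqn_pmul2r // => /eqP.
Qed.

Lemma bseq_mul_le (p : n.-bseq 'I_n) t : (t < size p)%N -> (t * l + l <= n * l)%N.
Proof.
by move=> tp; rewrite -mulSnr leq_mul2r (leq_trans tp (size_bseq p)) orbT.
Qed.

Lemma le_width p t : (t < size p)%N -> (t * l + m < width p)%N.
Proof. by move=> tp; rewrite /width addnS ltnS leq_add2r leq_mul2r; lia. Qed.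

(** Two points at distance at most [m] cannot belong to different runs: the start
of one of the two runs would lie among the cells reserved by the other.  In the
same run their distance is the one along the path, because a run is too short to
wrap around the cycle. *)
Lemma fits_close x P (p p' : n.-bseq 'I_n) t t' s :
  fits x P -> p \in P -> p' \in P -> (t < size p)%N -> (t' < size p')%N ->
  (s <= m)%N -> x (nth v0 p' t') = x (nth v0 p t) + s%:R ->
  p = p' /\ (t' * l = t * l + s)%N.
Proof.
move=> /andP[/'forall_implyP sP /'forall_implyP wP] pP p'P tp tp' sm.
rewrite (chain_pos (sP _ pP) tp) (chain_pos (sP _ p'P) tp') -addrA -natrD.
have tl := bseq_mul_le tp; have tl' := bseq_mul_le tp'.
have nl : (n.+1 * l = l + n * l)%N by rewrite mulSn.
have [<-|pp'] := eqVneq p p'.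
  by move=> /addrI e; split=> //; apply: natr_ord_inj e; lia.
have := wP _ pP; move=> /'forall_implyP/(_ _ p'P)/implyP/(_ pp') w1.
have := wP _ p'P; move=> /'forall_implyP/(_ _ pP); rewrite eq_sym => /implyP/(_ pp') w2 E.
have tw := le_width tp; have tw' := le_width tp'.
have [le|lt] := leqP (t' * l) (t * l + s).
  have yE : x (head v0 p') = x (head v0 p) + (t * l + s - t' * l)%:R.
    by apply: (addIr (t' * l)%:R); rewrite E -addrA -natrD subnK.
  by exfalso; have := leq_trans tw w1; rewrite yE cgap_natr; lia.
have yE : x (head v0 p) = x (head v0 p') + (t' * l - (t * l + s))%:R.
  by apply: (addIr (t * l + s)%:R); rewrite -E -addrA -natrD subnK // ltnW.
by exfalso; have := leq_trans tw' w2; rewrite yE cgap_natr; lia.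
Qed.

(** A point [l] steps before or after a run is within [m] of it, so
[fits_close] would put it in the same run, at a position that does not exist. *)
Lemma fits_maximal x P (p : n.-bseq 'I_n) :
  is_path_cover Gamma P -> fits x P -> p \in P -> maximal_chain x p.
Proof.
move=> /path_coverP[h1 h2 h3] fP pP.
have /and3P[p0 _ _] := h1 _ pP.
have sp : (0 < size p)%N by rewrite lt0n size_eq0.
apply/and4P; split=> //.
- by case/andP: fP => /'forall_implyP/(_ _ pP).
- apply/forallP => w; apply/negP => /eqP; have [p' p'P wp'] := h3 w.
  rewrite -nth0 -(nth_index v0 wp') => /(fits_close fP p'P pP).
  by rewrite index_mem wp' => /(_ isT sp l_le_m)[_]; lia.
- apply/forallP => w; apply/negP => /eqP; have [p' p'P wp'] := h3 w.
  rewrite -nth_last -(nth_index v0 wp') => /(fits_close fP pP p'P).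
  rewrite index_mem wp' => /(_ _ isT l_le_m)[|pp' e]; first by lia.
  have ip : (index w p' < size p)%N by rewrite pp' index_mem.
  have : ((index w p') * l <= (size p).-1 * l)%N by rewrite leq_mul2r; lia.
  by rewrite e -[X in (_ <= X)%N]addn0 leq_add2l leqNgt l_gt0.
Qed.

Lemma admissible_inj x : admissible x -> injective x.
Proof.
move=> /forallP ax i j xij; apply/eqP/negPn/negP => ij.
have /forallP/(_ j)/implyP/(_ ij) := ax i.
by rewrite xij /cgap subrr /=; lia.
Qed.

Lemma fits_admissible x P : good_cover P -> fits x P -> admissible x.
Proof.
move=> /andP[/path_coverP[h1 h2 h3] small] fP.
suff main (i j : 'I_n) : i != j -> (cgap (x i) (x j) <= m)%N ->
    (cgap (x i) (x j) == l) && Gamma i j.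
  apply/forallP => i; apply/forallP => j; apply/implyP => ij.
  by apply/implyP; apply: main.
move=> ij; have [p pP ip] := h3 i; have [p' p'P jp'] := h3 j.
set s := cgap _ _ => sm; have := cgapK (x i) (x j); rewrite -/s.
rewrite -{1}(nth_index v0 ip) -{1}(nth_index v0 jp') => /(fits_close fP pP p'P).
rewrite !index_mem ip jp' => /(_ isT isT sm)[pp' e]; subst p'.
have jp := jp'; have {}jp' : (index j p < size p)%N by rewrite index_mem.
have sE : s = ((index j p - index i p) * l)%N by rewrite mulnBl e addKn.
have [k kE] : exists k, index j p = (index i p + k)%N.
  exists (index j p - index i p)%N; rewrite subnKC //.
  by rewrite -(@leq_pmul2r l) // e leq_addr.
rewrite kE addKn in sE.
case: k => [|[|k]] in kE sE.
- case/eqP: ij; rewrite -(nth_index v0 ip) -(nth_index v0 jp).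
  by rewrite kE addn0.
- rewrite sE mul1n eqxx /=; have /and3P[_ _ /(sortedP v0)] := h1 _ pP.
  by move/(_ (index i p)); rewrite addn1 in kE; rewrite -kE !nth_index //; apply.
- have : (2 * l <= k.+2 * l)%N by rewrite leq_mul2r orbT.
  case/orP: small; first by lia.
  by move/'forall_implyP/(_ p pP) => p2; have := leq_trans jp' p2; lia.
Qed.

(** A longer [p'] would continue [p] beyond its end. *)
Lemma maximal_chain_size x p p' : injective x ->
  maximal_chain x p -> maximal_chain x p' -> head v0 p = head v0 p' ->
  (size p' <= size p)%N.
Proof.
move=> xI /and4P[p0 sp _ /forallP lp] /and4P[_ sp' _ _] hh.
rewrite leqNgt; apply/negP => lt; case/negP: (lp (nth v0 p' (size p))).
have p_gt0 : (0 < size p)%N by rewrite lt0n size_eq0.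
rewrite /step (chain_pos sp' lt) -nth_last (chain_pos sp) ?prednK // hh.
by rewrite -addrA -natrD -mulSnr prednK.
Qed.

(** Going back from the common vertex, the chain whose start is reached first could be
extended backwards along the other one, so both start at the same vertex; then
neither can be longer than the other. *)
Lemma maximal_chain_eq x p p' w : injective x ->
  maximal_chain x p -> maximal_chain x p' -> w \in p -> w \in p' -> p = p'.
Proof.
move=> xI; wlog le : p p' / (index w p <= index w p')%N.
  move=> IH mp mp' wp wp'; have [|/ltnW] := leqP (index w p) (index w p') => h.
    exact: IH.
  by apply/esym; apply: IH.
move=> mp mp' wp wp'.
have /and4P[p0 sp /forallP hp _] := mp; have /and4P[p0' sp' _ _] := mp'.
have wp1 : (index w p < size p)%N by rewrite index_mem.
have wp1' : (index w p' < size p')%N by rewrite index_mem.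
have dlt : (index w p' - index w p < size p')%N by lia.
have hE : nth v0 p' (index w p' - index w p) = head v0 p.
  apply/xI/(addIr (index w p * l)%:R).
  rewrite -(chain_pos sp wp1) (chain_pos sp' dlt) -addrA -natrD -mulnDl subnK //.
  by rewrite -(chain_pos sp' wp1') !nth_index.
have hh : head v0 p = head v0 p'.
  case: (index w p' - index w p)%N dlt hE => [|k] dlt hE; first by rewrite -hE nth0.
  case/negP: (hp (nth v0 p' k)); rewrite -hE.
  by move/(sortedP v0): sp'; apply.
have ss : size p = size p'.
  by apply/eqP; rewrite eqn_leq !(@maximal_chain_size x).
apply: (@eq_from_nth _ v0) => // i ip; apply: xI.
by rewrite (chain_pos sp ip) (chain_pos sp') -?ss // hh.
Qed.

(** A chain through [w] with the largest number of vertices is maximal. *)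
Lemma maximal_chain_exists x w :
  exists2 p : n.-bseq 'I_n, maximal_chain x p & w \in p.
Proof.
have n_gt0 : (0 < n)%N by apply: leq_ltn_trans (ltn_ord v0).
pose C := [pred p : n.-bseq 'I_n | sorted (step x) p && (w \in p)].
have Cext s : sorted (step x) s -> w \in s -> (size s <= n.+1)%N ->
    exists2 p : n.-bseq 'I_n, C p & size p = size s.
  (* n + 1 steps do not go around the cycle, so the extended chain repeats no
     vertex and still has at most n of them *)
  move=> ss ws sn; have su := chain_uniq ss sn.
  have sn' : (size s <= n)%N.
    by rewrite -[n in (_ <= n)%N]card_ord -(card_uniqP su) max_card.
  by exists (Bseq sn') => //=; rewrite ss.
have [p0 Cp0 _] := Cext [:: w] isT (mem_head _ _) isT.
have [p /andP[sp wp] pmax] : exists2 p : n.-bseq 'I_n, C p &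
    forall p' : n.-bseq 'I_n, C p' -> (size p' <= size p)%N.
  have [p Cp pmax] := @arg_maxnP _ p0 C (fun p : n.-bseq 'I_n => size p) Cp0.
  by exists p.
exists p => //; apply/and4P; split=> //.
- by apply/eqP => p_nil; have : w \in (p : seq 'I_n) := wp; rewrite p_nil.
- apply/forallP => v; apply/negP => vp.
  have sp' : sorted (step x) (v :: p).
    by case: (val p) sp vp => //= a s -> ->.
  have [||p' Cp' p'E] := Cext _ sp'; rewrite ?inE ?wp ?orbT //=.
    by rewrite ltnS size_bseq.
  by have := pmax _ Cp'; rewrite p'E /= ltnn.
- apply/forallP => v; apply/negP => vp.
  have sp' : sorted (step x) (rcons p v).
    by case: (val p) sp vp => //= a s; rewrite rcons_path => -> ->.
  have [||p' Cp' p'E] := Cext _ sp'; rewrite ?mem_rcons ?inE ?wp ?orbT //=.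
    by rewrite size_rcons ltnS size_bseq.
  by have := pmax _ Cp'; rewrite p'E size_rcons ltnn.
Qed.

Lemma admissible_step x i j : admissible x -> step x i j -> Gamma i j.
Proof.
move=> /forallP ax /eqP e; have ij : i != j.
  apply/eqP => ij; move: e; rewrite -ij -[LHS]addr0 => /addrI e'.
  have nl : (n.+1 * l = l + n * l)%N by rewrite mulSn.
  have := @natr_ord_inj q 0 l _ _ e'; lia.
have /forallP/(_ j)/implyP/(_ ij) := ax i.
have nl : (n.+1 * l = l + n * l)%N by rewrite mulSn.
by rewrite e cgap_natr ?l_le_m ?eqxx //=; lia.
Qed.

Definition cover_of x : {set n.-bseq 'I_n} := [set p : n.-bseq 'I_n | maximal_chain x p]%SET.

Lemma cover_of_good x : admissible x -> good_cover (cover_of x).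
Proof.
move=> ax; have xI := admissible_inj ax.
apply/andP; split.
  apply/path_coverP; split.
  - move=> p; rewrite inE => /and4P[p0 sp _ _]; apply/and3P; split=> //.
      by apply: (chain_uniq sp); rewrite ltnW // ltnS size_bseq.
    by apply: sub_sorted sp => i j; apply: admissible_step.
  - move=> p p' v; rewrite !inE => mp mp' vp vp'; apply/val_inj.
    exact: (maximal_chain_eq xI mp mp' vp vp').
  - by move=> v; have [p mp vp] := maximal_chain_exists x v; exists p; rewrite ?inE.
have [//|m2l] := ltnP; apply/'forall_implyP => p; rewrite inE => /and4P[_ sp _ _].
rewrite leqNgt; apply/negP => p3.
have nl : (n.+1 * l = l + n * l)%N by rewrite mulSn.
have e : x (nth v0 p 2) = x (nth v0 p 0) + (2 * l)%:R.
  by rewrite (chain_pos sp p3) nth0.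
have ij : nth v0 p 0 != nth v0 p 2.
  rewrite nth_uniq //; first exact: ltn_trans p3.
  by apply: (chain_uniq sp); rewrite ltnW // ltnS size_bseq.
move/forallP/(_ (nth v0 p 0))/forallP/(_ (nth v0 p 2))/implyP/(_ ij): ax.
rewrite e cgap_natr; last by lia.
lia.
Qed.

(** If a run started inside the cells reserved by another, it would start at
distance at most [m] after some vertex of that run; admissibility leaves only
the distance [l], and then it would not be maximal. *)
Lemma cover_of_fits x : admissible x -> fits x (cover_of x).
Proof.
move=> ax; have xI := admissible_inj ax.
have nl : (n.+1 * l = l + n * l)%N by rewrite mulSn.
apply/andP; split; first by apply/'forall_implyP => p; rewrite inE => /and4P[].
apply/'forall_implyP => p; rewrite inE => mp.
apply/'forall_implyP => p'; rewrite inE => mp'; apply/implyP => pp'.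
have /and4P[p0 sp _ /forallP lp] := mp; have /and4P[p0' sp' /forallP hp' _] := mp'.
rewrite leqNgt; apply/negP; rewrite /width addnS ltnS; set g := cgap _ _ => gle.
have gE : x (head v0 p') = x (head v0 p) + g%:R by apply: cgapK.
have p_gt0 : (0 < size p)%N by rewrite lt0n size_eq0.
(* the last vertex of p that is not after the start of p' *)
have [t [tp tg gt]] : exists t, [/\ (t < size p)%N, (t * l <= g)%N & (g - t * l <= m)%N].
  have [h|h] := leqP ((size p).-1 * l) g.
    by by exists (size p).-1; split; rewrite ?prednK // leq_subLR.
  exists (g %/ l)%N; split; last by have := ltn_pmod g l_gt0; have := divn_eq g l; lia.
    by rewrite ltn_divLR // (leq_trans h) // leq_mul2r leq_pred orbT.
  exact: leq_divM.
have e : x (head v0 p') = x (nth v0 p t) + (g - t * l)%:R.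
  by rewrite gE (chain_pos sp tp) -addrA -natrD subnKC.
have [ij|ij] := eqVneq (nth v0 p t) (head v0 p').
  case/eqP: pp'; apply/val_inj; apply: (maximal_chain_eq xI mp mp' (w := head v0 p')).
    by rewrite -ij mem_nth.
  by rewrite -nth0 mem_nth // lt0n size_eq0.
have gap : cgap (x (nth v0 p t)) (x (head v0 p')) = (g - t * l)%N.
  by rewrite e cgap_natr; lia.
move/forallP/(_ (nth v0 p t))/forallP/(_ (head v0 p'))/implyP/(_ ij): ax.
rewrite gap gt /= => /andP[/eqP gl _].
by case/negP: (hp' (nth v0 p t)); rewrite /step e gl.
Qed.

Lemma fits_unique x P : is_path_cover Gamma P -> fits x P -> injective x -> P = cover_of x.
Proof.
move=> cP fP xI; apply/setP => p; rewrite inE; apply/idP/idP => [|mp].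
  exact: fits_maximal.
have /path_coverP[_ _ h3] := cP; have [p' p'P hp'] := h3 (head v0 p).
suff <- : p' = p by [].
apply/val_inj; apply: (maximal_chain_eq xI _ mp hp'); first exact: fits_maximal fP p'P.
by case/and4P: mp => p0 _ _ _; rewrite -nth0 mem_nth // lt0n size_eq0.
Qed.

(** The cover of a configuration is the set of its maximal chains, and no other good
cover fits it. *)
Lemma card_admissible :
  #|admissible| = (\sum_(P | good_cover P) #|[pred x | fits x P]|)%N.
Proof.
under eq_bigr => P _ do rewrite -sum1_card.
rewrite (exchange_big_dep xpredT) //= -sum1_card [LHS]big_mkcond /=.
apply: eq_bigr => x _; rewrite unfold_in; case: ifPn => ax.
  rewrite (big_pred1 (cover_of x)) // => P; apply/andP/eqP => [[/andP[cP _] fP]|->].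
    by apply: fits_unique => //; apply: admissible_inj.
  by split; [apply: cover_of_good|apply: cover_of_fits].
rewrite big_pred0 // => P; apply/negbTE/negP => /andP[gP fP].
by case/negP: ax; apply: fits_admissible gP fP.
Qed.

End Configurations.

(** * Counting the configurations of a given path cover *)

Section CountFits.
Variables (n : nat) (v0 : 'I_n) (Gamma : rel 'I_n) (m l q : nat).

(** A configuration is determined by the positions of the first vertices. *)
Lemma card_fits_on_cycle (P : {set n.-bseq 'I_n}) : is_path_cover Gamma P ->
  #|[pred x : {ffun 'I_n -> 'I_q.+2} | fits v0 m l x P]| =
  #|(on_cycle (fun p : {p | p \in P} => width m l (val p)) :
      pred {ffun {p | p \in P} -> 'I_q.+2})|.
Proof.
move=> /path_coverP[h1 h2 h3].
have [pv pvP] : exists pv : 'I_n -> {p | p \in P}, forall v, v \in val (pv v).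
  have /choice[pv pvP] : forall v, exists p : {p | p \in P}, v \in val p.
    by move=> v; have [p pP vp] := h3 v; exists (exist _ p pP).
  by exists pv.
have pvE p v (pP : p \in P) : v \in p -> pv v = exist _ p pP.
  move=> vp; apply/val_inj => /=; apply: (h2 _ _ v) => //; first exact: (svalP (pv v)).
have size_gt0 p : p \in P -> (0 < size p)%N.
  by move=> /h1 /and3P[p0 _ _]; rewrite lt0n size_eq0.
apply: (@card_pred_bij _ _ _ _
  (fun x : {ffun 'I_n -> 'I_q.+2} => [ffun p : {p | p \in P} => x (head v0 (val p))])
  (fun y : {ffun {p | p \in P} -> 'I_q.+2} =>
     [ffun v => y (pv v) + (index v (val (pv v)) * l)%:R])).
- move=> x /andP[/'forall_implyP sP /'forall_implyP wP]; split; last first.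
    apply/ffunP => v; rewrite !ffunE -(@chain_pos _ _ _ _ _ (val (pv v))).
    + by rewrite nth_index.
    + exact: sP (svalP (pv v)).
    + by rewrite index_mem.
  apply/forallP => p; apply/forallP => p'; apply/implyP => pp'; rewrite !ffunE.
  by have /'forall_implyP/(_ _ (svalP p'))/implyP := wP _ (svalP p); apply.
- move=> y /forallP cy.
  have yE p (pP : p \in P) t : (t < size p)%N ->
      [ffun v => y (pv v) + (index v (val (pv v)) * l)%:R] (nth v0 p t) =
      y (exist _ p pP) + (t * l)%:R.
    move=> tp; rewrite ffunE (@pvE p _ pP) ?mem_nth //= index_uniq //.
    by have /and3P[] := h1 p pP.
  have yh p (pP : p \in P) :
      [ffun v => y (pv v) + (index v (val (pv v)) * l)%:R] (head v0 p) = y (exist _ p pP).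
    by rewrite -nth0 (@yE p pP) ?size_gt0 // mul0n addr0.
  split.
    apply/andP; split; apply/'forall_implyP => p pP.
      apply/(sortedP v0) => t tp; rewrite /step (yE p pP) // (yE p pP) ?(ltnW tp) //.
      by rewrite mulSnr natrD addrA.
    apply/'forall_implyP => p' p'P; apply/implyP => pp'; rewrite !yh.
    have /forallP/(_ (exist _ p' p'P))/implyP := cy (exist _ p pP); apply.
    by apply: contra pp' => /eqP[->].
  by apply/ffunP => -[p pP]; rewrite ffunE /= (yh _ pP).
Qed.

(** The cells lost by shrinking are [(size p).-1 * l + m] for each path [p], and the
sizes of the paths add up to [n]. *)
Lemma card_fits (P : {set n.-bseq 'I_n}) : is_path_cover Gamma P ->
  (n * (l + m) <= q)%N ->
  #|[pred x : {ffun 'I_n -> 'I_q.+2} | fits v0 m l x P]| =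
  (q.+2 * (q.+1 - ((n - #|P|) * l + #|P| * m)) ^_ #|P|.-1)%N.
Proof.
move=> cP qn; rewrite card_fits_on_cycle //.
have /path_coverP[h1 h2 h3] := cP; have [p0 p0P _] := h3 v0.
have sumE : (\sum_(p : {p | p \in P}) (width m l (val p)).-1 =
    (n - #|P|) * l + #|P| * m)%N.
  transitivity (\sum_(p in P) ((size p).-1 * l + m))%N.
    by rewrite [RHS]big_sub; apply: eq_bigr => p _; rewrite /width addnS.
  rewrite big_split /= sum_nat_const; congr (_ + _)%N.
  transitivity ((\sum_(p in P) size p - \sum_(p in P) 1) * l)%N; last first.
    by rewrite (sum_size_path_cover cP) sum1_card.
  rewrite -sumnB => [|p /h1 /and3P[]]; last by case: (val p).
  by rewrite big_distrl /=; apply: eq_bigr => p _; rewrite subn1.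
rewrite (@card_placements _ (exist _ p0 p0P)).
- by rewrite sumE card_sig.
- by move=> p; rewrite /width addnS.
- rewrite sumE leqW // (leq_trans _ qn) // mulnDr leq_add // leq_mul2r ?leq_subr ?orbT //.
  by rewrite (card_path_cover cP) orbT.
Qed.
End CountFits.

(** * Matchings as path covers with short paths *)

Section Matchings.
Local Open Scope nat_scope.
Variables (n : nat) (v0 : 'I_n) (Gamma : rel 'I_n).
Implicit Types (M : {set 'I_n * 'I_n}) (P : {set n.-bseq 'I_n}).

Definition ends (e : 'I_n * 'I_n) : seq 'I_n := [:: e.1; e.2].

Lemma matchingP M :
  reflect ((forall e, e \in M -> Gamma e.1 e.2) /\
           (forall e e' v, e \in M -> e' \in M -> v \in ends e -> v \in ends e' -> e = e'))
          (is_matching Gamma M).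
Proof.
apply: (iffP andP) => [[/'forall_implyP h1 /'forall_implyP h2]|[h1 h2]].
  split=> // e e' v eM e'M ve ve'; apply/eqP/negPn/negP => ee'.
  have /'forall_implyP/(_ e' e'M)/implyP/(_ ee') d := h2 e eM.
  by have := disjointFr d ve; rewrite ve'.
split; first exact/'forall_implyP.
apply/'forall_implyP => e eM; apply/'forall_implyP => e' e'M; apply/implyP => ee'.
rewrite disjoint_subset; apply/fintype.subsetP => v ve; rewrite inE.
by apply: contra ee' => ve'; apply/eqP; apply: h2 ve ve'.
Qed.

Definition small_cover P := is_path_cover Gamma P && [forall p in P, size p <= 2].

Definition matching_of P : {set 'I_n * 'I_n} :=
  [set e | [exists p in P, val p == ends e]]%SET.

Definition cover_of_matching M : {set n.-bseq 'I_n} :=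
  [set p : n.-bseq 'I_n | match val p with
     | [:: a; b] => (a, b) \in M
     | [:: a] => [forall e in M, a \notin ends e]
     | _ => false end]%SET.

Lemma matching_ofP P e :
  reflect (exists2 p : n.-bseq 'I_n, p \in P & val p = ends e) (e \in matching_of P).
Proof.
rewrite inE; apply: (iffP 'exists_andP) => [[p [pP /eqP pe]]|[p pP pe]]; exists p => //.
by rewrite pe eqxx.
Qed.

(** A path with two vertices contributes one arc, a path with one vertex none. *)
Lemma card_small_cover P : small_cover P -> #|P| + #|matching_of P| = n.
Proof.
move=> /andP[cP /'forall_implyP small]; have /path_coverP[h1 h2 h3] := cP.
rewrite -[RHS](sum_size_path_cover cP).
have -> : #|matching_of P| = #|[pred p : n.-bseq 'I_n | (p \in P) && (size p == 2)]|.
  apply: (@card_pred_bij _ _ _ _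
    (fun e : 'I_n * 'I_n => insub_bseq n [:: e.1; e.2])
    (fun p : n.-bseq 'I_n => (nth v0 p 0, nth v0 p 1))).
  - move=> [a b] h; have /matching_ofP[p pP pe] : (a, b) \in matching_of P := h.
    have -> : insub_bseq n [:: (a, b).1; (a, b).2] = p.
      by apply/val_inj; rewrite -[X in insub_bseq _ X]pe /insub_bseq /= valKd.
    by split; [apply/andP; rewrite pP pe|rewrite pe].
  - move=> p /andP[pP /eqP sp].
    have pE : val p = [:: nth v0 p 0; nth v0 p 1].
      by case: p sp {pP} => -[|a [|b []]].
    split; last by apply/val_inj; rewrite /= -pE /insub_bseq valKd.
    by apply/matching_ofP; exists p.
rewrite -sum1_card -[X in _ + X]sum1_card big_mkcondr -big_split /=.
apply: eq_bigr => p pP; have /and3P[p0 _ _] := h1 p pP; have := small p pP.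
by case: (val p) p0 => [|a [|b [|]]].
Qed.

Lemma matching_of_matching P : small_cover P -> is_matching Gamma (matching_of P).
Proof.
move=> /andP[/path_coverP[h1 h2 h3] _]; apply/matchingP; split.
  move=> e /matching_ofP[p pP pe]; have /and3P[_ _] := h1 p pP.
  by rewrite pe /= andbT.
move=> e e' v /matching_ofP[p pP pe] /matching_ofP[p' p'P pe'].
rewrite -pe -pe' => vp vp'; have pp' := h2 p p' v pP p'P vp vp'.
by move: pe'; rewrite -pp' pe; case: e e' {pe} => [? ?] [? ?] [-> ->].
Qed.

Lemma matching_ofK P : small_cover P -> cover_of_matching (matching_of P) = P.
Proof.
move=> /andP[/path_coverP[h1 h2 h3] /'forall_implyP small].
apply/setP => p; rewrite inE.
case E: (val p) => [|a [|b [|c s]]].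
- by apply/esym/negP => /h1 /and3P[]; rewrite E.
- apply/'forall_implyP/idP => [h|pP [b c] /matching_ofP[p' p'P p'E]].
    have [p' p'P ap'] := h3 a; have /and3P[p0' _ _] := h1 _ p'P.
    suff -> : p = p' by [].
    apply/val_inj; rewrite E; have sz : size (val p') <= 2 := small _ p'P.
    have {}ap' : a \in val p' := ap'.
    case E': (val p') p0' ap' sz => [|b [|c [|]]] // _.
      by rewrite inE => /eqP->.
    move=> abc _; suff /h/negP[] : (b, c) \in matching_of P by [].
    by apply/matching_ofP; exists p'.
  apply/negP => abc; have ap' : a \in val p' by rewrite p'E.
  have ap : a \in val p by rewrite E mem_head.
  by move: E; rewrite (h2 p p' a) // p'E.
- apply/matching_ofP/idP => [[p' p'P p'E]|pP]; last by exists p.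
  by rewrite (_ : p = p') //; apply/val_inj; rewrite E p'E.
- by apply/esym/negP => /small; rewrite E.
Qed.

Hypothesis irr : irreflexive Gamma.

Lemma bseq_of_edge M e : is_matching Gamma M -> e \in M ->
  exists p : n.-bseq 'I_n, val p = ends e.
Proof.
move=> /matchingP[h1 _] /h1 ge; have u : uniq (ends e).
  by rewrite /= inE andbT; apply: contraTneq ge => ->; rewrite irr.
have sn : size (ends e) <= n.
  by rewrite -[n in _ <= n]card_ord -(card_uniqP u) max_card.
by exists (Bseq sn).
Qed.

Lemma cover_of_matchingK M : is_matching Gamma M -> matching_of (cover_of_matching M) = M.
Proof.
move=> mM; apply/setP => e; apply/matching_ofP/idP => [[p]|eM].
  by rewrite inE => + pe; rewrite pe /=; case: e {pe}.
have [p pe] := bseq_of_edge mM eM; exists p => //.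
by rewrite inE pe /=; case: e eM {pe}.
Qed.

Lemma cover_of_matching_small M :
  is_matching Gamma M -> small_cover (cover_of_matching M).
Proof.
move=> mM; have /matchingP[h1 h2] := mM; apply/andP; split; last first.
  by apply/'forall_implyP => p; rewrite inE; case: p => -[|a [|b [|]]].
apply/path_coverP; split.
- move=> p; rewrite inE /is_dipath; case: p => -[|a [|b [|]]] sz //= /h1 /= ab.
  by rewrite ab inE !andbT; apply: contraTneq ab => ->; rewrite irr.
- move=> p p' v; rewrite !inE => hp hp' vp vp'; apply/val_inj.
  have {}vp : v \in val p := vp; have {}vp' : v \in val p' := vp'.
  case: (val p) (val p') hp hp' vp vp' => [|a [|b [|]]] // [|a' [|b' [|]]] //.
  + by move=> _ _; rewrite !inE => /eqP<- /eqP<-.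
  + move=> /'forall_implyP h /h /= av; rewrite inE => /eqP->.
    by rewrite /ends /= in av *; rewrite (negPf av).
  + move=> + /'forall_implyP h => /h /= av; rewrite [_ \in [:: a']]inE => + /eqP va.
    by rewrite va /ends /= in av *; rewrite (negPf av).
  + move=> e e' ve ve'.
    by have [-> ->] := h2 (a, b) (a', b') v e e' ve ve'.
- move=> v; have [/existsP[e /andP[eM ve]]|h] := boolP [exists e, (e \in M) && (v \in ends e)].
    have [p pe] := bseq_of_edge mM eM; exists p; last by rewrite -[v \in p]/(v \in val p) pe.
    by rewrite inE pe /=; case: e eM {pe ve}.
  have n1 : size [:: v] <= n by case: n v {h} => // -[].
  exists (Bseq n1); last by rewrite inE.
  rewrite inE /=; apply/'forall_implyP => e eM; apply: contra h => ve.
  by apply/existsP; exists e; rewrite eM.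
Qed.

Lemma mat_small_covers k : k <= n ->
  mat Gamma (n - k) =
  #|[pred P : {set n.-bseq 'I_n} | small_cover P && (#|P| == k)]|.
Proof.
move=> kn; apply: (@card_pred_bij _ _ _ _ cover_of_matching matching_of).
- move=> M /andP[mM /eqP Mk]; split; last exact: cover_of_matchingK.
  have sM := cover_of_matching_small mM; apply/andP; split=> //.
  by have := card_small_cover sM; rewrite cover_of_matchingK //; lia.
- move=> P /andP[sP /eqP Pk]; split; last exact: matching_ofK.
  apply/andP; split; first exact: matching_of_matching.
  by have := card_small_cover sP; lia.
Qed.

End Matchings.

(** * The characteristic polynomial *)

Lemma poly_eq_large (p r : {poly int}) N :
  (forall q, (N <= q)%N -> p.[q.+2%:R] = r.[q.+2%:R]) -> p = r.
Proof.
move=> pr; apply/eqP; rewrite -subr_eq0; apply/negPn/negP => d0.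
pose s : seq int := [seq q.+2%:R | q <- iota N (size (p - r))].
have sr : all (root (p - r)) s.
  apply/allP => z /mapP[q]; rewrite mem_iota => /andP[Nq _] ->.
  by rewrite rootE hornerD hornerN pr // subrr.
have su : uniq s.
  rewrite map_inj_uniq ?iota_uniq // => i j /eqP.
  by rewrite eqr_nat => /eqP[].
by have := max_poly_roots d0 sr su; rewrite size_map size_iota ltnn.
Qed.

Lemma horner_falling c r q : (c + r <= q)%N ->
  (falling ('X - c%:R) r).[q%:R] = ((q - c) ^_ r)%:R :> int.
Proof.
move=> cq; rewrite /falling horner_prod ffact_prod natr_prod.
apply: eq_bigr => i _; rewrite !hornerE -?polyC_natr ?hornerC.
have iq : (i <= q - c)%N by have := ltn_ord i; lia.
by rewrite natrB // natrB //; lia.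
Qed.

(** The vector with the only nonzero entry [s'] at [p'.1] and the one with [- s'] at
[p'.2] lie on both hyperplanes.  As [s] is positive, the origin being on neither
hyperplane, the first vector forces [p.1 = p'.1] and the second [p.2 = p'.2]. *)
Lemma diff_hyp_inj (R : realType) n (s s' : nat) (p p' : 'I_n * 'I_n) :
  p'.1 != p'.2 -> (0 < s')%N ->
  diff_hyp s%:R p = diff_hyp s'%:R p' :> set 'rV[R]_n -> s = s' /\ p = p'.
Proof.
move=> p12 s'0 /seteqP[h h'].
have s0 : (0 < s)%N.
  rewrite lt0n; apply/eqP => s0; have := h 0; rewrite /diff_hyp /=.
  rewrite !mxE subrr s0 => /(_ erefl)/esym/eqP.
  by rewrite pnatr_eq0; lia.
have h1 := h' (\row_k (s'%:R *+ (k == p'.1))); have h2 := h' (\row_k (- s'%:R *+ (k == p'.2))).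
rewrite /diff_hyp /= !mxE eqxx eq_sym (negPf p12) subr0 in h1.
rewrite /diff_hyp /= !mxE eqxx (negPf p12) sub0r opprK in h2.
have pos : 0 < s%:R :> R by rewrite ltr0n.
move: (h1 erefl) (h2 erefl); case: (p.1 =P p'.1) => [e1|_ e]; last first.
  by move: pos; rewrite -e mulr0n sub0r oppr_gt0 ltNge mulrn_wge0 // ler0n.
case: (p.2 =P p'.2) => [e2|_ _ e]; last first.
  by move: pos; rewrite -e mulr0n subr0 mulNrn oppr_gt0 ltNge mulrn_wge0 // ler0n.
rewrite e2 eq_sym (negPf p12) mulr0n subr0 mulr1n => /eqP + _.
by rewrite eqr_nat => /eqP ->; split=> //; case: p p' e1 e2 {p12 h h' h1 h2} => ? ? [? ?] /= -> ->.
Qed.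

(** The hyperplanes [x_i = x_j] are indexed here by both orders of [i] and [j], which
makes the index set symmetric.  Deleting a hyperplane amounts to deleting its
index, by [diff_hyp_inj]. *)
Lemma mem_deleted_catalan (R : realType) n m l (Gamma : rel 'I_n) (h : set 'rV[R]_n) :
  irreflexive Gamma -> (0 < l)%N ->
  h \in deleted_catalan R m l Gamma <->
  exists2 t : 'I_n * 'I_n * 'I_m.+1,
    t \in [set t : 'I_n * 'I_n * 'I_m.+1 | (t.1.1 != t.1.2) &&
       ~~ ((t.2 == l :> nat) && Gamma t.1.1 t.1.2)]%SET
    & h = diff_hyp (t.2 : nat)%:R t.1.
Proof.
move=> irr l0; rewrite /deleted_catalan in_fsetD; split.
- move=> /andP[hD]; rewrite in_fsetU => /orP[/imfsetP[[i j] /= ij hE]|/imfset2P[s /= sm [[i j] /= ij hE]]].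
    exists ((i, j), ord0) => //; rewrite inE /= (ltn_eqF l0) /= andbT.
    have {}ij : (i < j)%N := ij; by rewrite -(inj_eq val_inj) /= (ltn_eqF ij).
  have {}ij : i != j := ij.
  have sm' : (s < m.+1)%N by move: sm; rewrite mem_iota add1n => /andP[].
  exists ((i, j), Ordinal sm') => //; rewrite inE /= ij /=.
  apply: contra hD => /andP[/eqP sl G]; apply/imfsetP; exists (i, j) => //.
  by rewrite hE sl.
- move=> [[[i j] s]]; rewrite inE /= => /andP[ij nG] ->; apply/andP; split.
    apply: contra nG => /imfsetP[[i' j'] /= G' E].
    have {}G' : Gamma i' j' := G'.
    have i'j' : i' != j' by apply: contraTneq G' => ->; rewrite irr.
    by have [-> [-> ->]] := diff_hyp_inj (p' := (i', j')) i'j' l0 E; rewrite eqxx.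
  rewrite in_fsetU; have [s0|s0] := posnP s; last first.
    apply/orP; right; apply/imfset2P; exists (s : nat).
      by rewrite mem_iota s0 add1n ltn_ord.
    by exists (i, j).
  apply/orP; left; apply/imfsetP; rewrite s0.
  have [lt|lt|e] := ltngtP i j; last by case/eqP: ij; apply/val_inj.
    by exists (i, j).
  exists (j, i) => //; rewrite /diff_hyp; apply/seteqP; split => x /= /subr0_eq ->;
  by rewrite subrr.
Qed.

Section Final.
Variables (R : realType) (n : nat) (v0 : 'I_n) (m l : nat) (Gamma : rel 'I_n).
Hypotheses (irr : irreflexive Gamma) (l_gt0 : (0 < l)%N) (l_le_m : (l <= m)%N).

Lemma charpoly_admissible : exists q0, forall q, (q0 <= q)%N ->
  (charpoly (deleted_catalan R m l Gamma)).[q.+2%:R] =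
  #|@admissible n Gamma m l q|%:R.
Proof.
have [|q0 h] := finite_field_method (e := fun t : 'I_n * 'I_n * 'I_m.+1 => (t.1, t.2 : nat))
  (fun h => @mem_deleted_catalan R n m l Gamma h irr l_gt0).
  by move=> t; rewrite inE => /andP[].
exists (maxn q0 m) => q; rewrite geq_max => /andP[q0q mq].
rewrite h //; congr (_%:R); apply: eq_card => x; rewrite [LHS]unfold_in [RHS]unfold_in.
apply/'forall_implyP/forallP => [hx i|hx [[i j] s]].
  apply/forallP => j; apply/implyP => ij; apply/implyP => sm.
  rewrite -ltnS in sm; have := hx (i, j, Ordinal sm).
  rewrite inE /solution_mod /= -cgapK eqxx ij /=.
  by case: (_ && _) => // /(_ isT).
rewrite inE /= => /andP[ij]; apply: contra => /eqP /= e.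
have /forallP/(_ j)/implyP/(_ ij) := hx i.
have sm : (s <= m)%N by rewrite -ltnS.
by rewrite e cgap_natr ?sm //; lia.
Qed.

Lemma charpoly_good_covers :
  charpoly (deleted_catalan R m l Gamma) =
  'X * \sum_(P | good_cover Gamma m l P)
         falling ('X - (theta n m l #|P|)%:R) #|P|.-1.
Proof.
have [q0 q0P] := charpoly_admissible.
(* n.+1 * l + m keeps runs from wrapping around, n * (l + m) leaves room for all
   the blocks, and the last n for the factors of the falling factorials *)
pose N := (maxn q0 (n.+1 * l + m + n * (l + m) + n))%N.
apply: (@poly_eq_large _ _ N) => q; rewrite geq_max => /andP[q0q Nq].
rewrite q0P // (@card_admissible _ v0) //; last by lia.
rewrite natr_sum hornerM hornerX horner_sum big_distrr /=.
apply: eq_bigr => P /andP[cP _]; rewrite (card_fits v0 cP); last by lia.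
rewrite natrM; congr (_ * _).
have key k : (k <= n)%N -> (theta n m l k + k.-1 <= q.+2)%N /\
    (q.+1 - ((n - k) * l + k * m) = q.+2 - theta n m l k)%N.
  move=> kn; have -> : theta n m l k = ((n - k) * l + k * m + 1)%N.
    by rewrite /theta; nia.
  have bnd : ((n - k) * l + k * m <= n * (l + m))%N.
    by rewrite mulnDr leq_add // leq_mul2r ?leq_subr ?kn orbT.
  by split; lia.
have [kq kE] := key _ (card_path_cover cP).
by rewrite horner_falling // kE.
Qed.

Lemma sum_by_card (T : finType) (S : pred {set T}) (V : nmodType) (F : nat -> V) a b :
  (forall P, S P -> a <= #|P| < b)%N ->
  \sum_(P | S P) F #|P| =
  \sum_(a <= k < b) F k *+ #|[pred P | S P && (#|P| == k)]|.
Proof.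
move=> ab; under [RHS]eq_bigr => k _ do rewrite -sumr_const.
rewrite (exchange_big_dep S) /=; last by move=> k P _ /andP[].
apply: eq_bigr => P SP; transitivity (\sum_(a <= k < b | k == #|P|) F k).
  by rewrite big_nat1_eq ab.
by apply: eq_bigl => k; rewrite inE SP eq_sym.
Qed.
End Final.

Theorem theorem2 (R : realType) (n m l : nat) (Gamma : rel 'I_n)
    (hn : (1 <= n)%N) (hm : (1 <= m)%N) (hl : (1 <= l <= m)%N)
    (simple_Gamma : irreflexive Gamma) :
  ((1 <= l <= m./2)%N ->
     charpoly (deleted_catalan R m l Gamma) =
       'X * \sum_(uphalf n <= k < n.+1)
              (falling ('X - (theta n m l k)%:R) k.-1) *+ mat Gamma (n - k)) /\
  ((m./2 + 1 <= l <= m)%N ->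
     charpoly (deleted_catalan R m l Gamma) =
       'X * \sum_(1 <= k < n.+1)
              (falling ('X - (theta n m l k)%:R) k.-1) *+ paths Gamma k).
Proof.
have /andP[l_gt0 l_le_m] := hl; pose v0 : 'I_n := Ordinal hn.
rewrite (charpoly_good_covers R v0) //.
split=> [/andP[_ lm]|/andP[lm _]]; congr (_ * _).
- rewrite (eq_bigl (small_cover Gamma)) => [|P]; last first.
    by rewrite /good_cover /small_cover; case: (ltnP m l.*2) => //; lia.
  rewrite (@sum_by_card _ _ _ (fun k => falling ('X - (theta n m l k)%:R) k.-1) (uphalf n) n.+1).
    apply: eq_big_nat => k /andP[_ kn].
    by rewrite (mat_small_covers v0).
  move=> P /andP[cP /'forall_implyP small]; rewrite ltnS (card_path_cover cP) andbT.
  rewrite leq_uphalf_double -[X in (X <= _)%N](sum_size_path_cover cP).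
  by rewrite -mul2n mulnC -sum_nat_const; apply: leq_sum => p /small.
- rewrite (eq_bigl (is_path_cover Gamma)) => [|P]; last first.
    by rewrite /good_cover; case: (ltnP m l.*2) => //; rewrite ?andbT //; lia.
  rewrite (@sum_by_card _ _ _ (fun k => falling ('X - (theta n m l k)%:R) k.-1) 1 n.+1) //.
  move=> P cP; rewrite ltnS (card_path_cover cP) andbT card_gt0; apply/finset.set0Pn.
  by have /path_coverP[_ _ /(_ v0)[p pP _]] := cP; exists p.
Qed.
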